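(* Let $n\ge 2$, let $C_n$ be a positive directed cycle on $n$ vertices and let $\mathbf{C}_n$ be a negative directed cycle on $n$ vertices. Then $$E(C_n)=\begin{cases}2\cot\frac{\pi}{n}, & n=4k,\\ \csc\frac{\pi}{2n}, & n=4k+1\text{ or }n=4k+3,\\ 2\csc\frac{\pi}{n}, & n=4k+2,\end{cases}$$ and $$E(\mathbf{C}_n)=\begin{cases}2\csc\frac{\pi}{n}, & n=4k,\\ \csc\frac{\pi}{2n}, & n=4k+1\text{ or }n=4k+3,\\ 2\cot\frac{\pi}{n}, & n=4k+2,\end{cases}$$ where $k$ denotes a nonnegative integer.
   Context: A sidigraph (signed digraph) is a pair $S=(D,\sigma)$, where $D=(V,\mathscr{A})$ is a digraph and $\sigma:\mathscr{A}\to\{-1,1\}$. Its adjacency matrix $A(S)=(a_{ij})$ has $a_{ij}=\sigma(v_i,v_j)$ if there is an arc from $v_i$ to $v_j$ and $0$ otherwise. The energy of $S$ is $E(S)=\sum_{j=1}^n|\Re z_j|$, where $z_1,\dots,z_n$ are the eigenvalues of $A(S)$ with multiplicity. A cycle of length $n$ is a sidigraph with vertices $v_1,\dots,v_n$ and signed arcs $(v_i,v_{i+1})$, $1\le i\le n-1$, and $(v_n,v_1)$; it is positive (negative) if the product of the signs of its arcs is $+1$ ($-1$). *)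

(* Defs.v *)
From HB Require Import structures.
From mathcomp Require Import all_boot all_order all_algebra.
From mathcomp Require Import complex.
From mathcomp Require Import reals trigo.
Set Implicit Arguments.
Unset Strict Implicit.
Unset Printing Implicit Defensive.
Import Order.TTheory GRing.Theory Num.Theory.
Local Open Scope ring_scope.
Local Open Scope complex_scope.

(* The values of [sign] outside [arcs] are irrelevant: every notion below
   reads [sign] on arcs only. *)
Record sidigraph (V : finType) := Sidigraph {
  arcs : {set V * V};
  sign : V * V -> int;
  sign_arc : forall a, a \in arcs -> sign a = 1 \/ sign a = -1 }.

(* The vertices are listed in the order of [enum V]. *)
Definition adjmx (K : pzRingType) (V : finType) (S : sidigraph V) :
    'M[K]_#|V| :=
  \matrix_(i, j)
    let a := (enum_val i, enum_val j) in
    if a \in arcs S then (sign S a)%:~R else 0.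

(* The eigenvalues of a complex matrix, with algebraic multiplicity. *)
Definition eigenvalues (R : realType) (m : nat) (A : 'M[R[i]]_m) : seq R[i] :=
  sval (closed_field_poly_normal (char_poly A)).

Lemma char_poly_eigenvalues (R : realType) (m : nat) (A : 'M[R[i]]_m) :
  char_poly A = \prod_(z <- eigenvalues A) ('X - z%:P).
Proof.
rewrite /eigenvalues; case: closed_field_poly_normal => s /= {1}->.
by rewrite (monicP (char_poly_monic A)) scale1r.
Qed.

Definition energy (R : realType) (V : finType) (S : sidigraph V) : R :=
  \sum_(z <- eigenvalues (adjmx R[i] S)) `|complex.Re z|.

(* [ordS] is the successor modulo [n], so that [v] lists the vertices in such
   a way that the arcs are exactly (v_1, v_2), ..., (v_(n-1), v_n), (v_n, v_1). *)
Definition is_dicycle (n : nat) (V : finType) (S : sidigraph V) : Prop :=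
  exists2 v : 'I_n -> V, bijective v &
    arcs S = [set (v i, v (ordS i)) | i : 'I_n].

Definition positive_dicycle (n : nat) (V : finType) (S : sidigraph V) : Prop :=
  is_dicycle n S /\ \prod_(a in arcs S) sign S a = 1.

Definition negative_dicycle (n : nat) (V : finType) (S : sidigraph V) : Prop :=
  is_dicycle n S /\ \prod_(a in arcs S) sign S a = -1.

Definition cot (R : realType) (x : R) : R := cos x / sin x.

Definition csc (R : realType) (x : R) : R := (sin x)^-1.

(* Main.v *)
(* An eigenvector for an [n]-th root [a] of the sign product is obtained by
   pushing the value 1 around the cycle, multiplying by [sign / a] along each
   arc.  This gives [n] distinct eigenvalues, with real parts
   [cos ((2 j + e) pi / n)], where the sign product is [(-1) ^ e].  Modulo [pi],
   the period of [|cos|], these angles are equally spaced: with step [pi / m],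
   each taken twice, if [n = 2 m], and with step [pi / n] if [n] is odd, because
   2 is then invertible modulo [n].  By periodicity the angles can be moved into
   [[pi/2, 3 pi/2]], where [cos] has constant sign, and the sum telescopes after
   multiplication by twice the sine of half the step. *)
Require Import Defs.
From mathcomp Require Import all_boot all_order all_algebra.
From mathcomp Require Import complex.
From mathcomp Require Import reals trigo.
From mathcomp Require Import ring lra zify.
Import Order.TTheory GRing.Theory Num.Theory.
Local Open Scope ring_scope.

(** * Eigenvalues of a signed cycle *)

Lemma perm_eigenvalues (R : realType) (m : nat) (A : 'M[R[i]%C]_m)
    (rs : seq R[i]%C) :
  uniq rs -> size rs = m -> {in rs, forall z, eigenvalue A z} ->
  perm_eq (eigenvalues A) rs.
Proof.
move=> uniq_rs size_rs eig_rs.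
have size_eig : size (eigenvalues A) = m.
  by apply/eqP; rewrite -eqSS -(size_char_poly A) char_poly_eigenvalues
    size_prod_XsubC.
have sub_rs : {subset rs <= eigenvalues A}.
  move=> z /eig_rs; rewrite eigenvalue_root_char char_poly_eigenvalues.
  by rewrite root_prod_XsubC.
(* The degree of the characteristic polynomial leaves only [m] entries, so [m] distinct eigenvalues
   exhaust the list, each simple. *)
have le_size : (size (eigenvalues A) <= size rs)%N by rewrite size_rs size_eig.
rewrite perm_sym; apply: uniq_perm => //.
  exact: (leq_size_uniq uniq_rs sub_rs le_size).
by have [_] := uniq_min_size uniq_rs sub_rs le_size.
Qed.

Lemma eigenvalue_dicycle (F : fieldType) (n : nat) (V : finType)
    (S : sidigraph V) (a : F) :
  (0 < n)%N -> is_dicycle n S ->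
  a ^+ n = (\prod_(e in arcs S) sign S e)%:~R ->
  eigenvalue (adjmx F S) a.
Proof.
case: n => // n _ [v v_bij arcsE] a_root.
have [g vK gK] := v_bij; have v_inj := bij_inj v_bij.
pose s i : F := (sign S (v i, v (ordS i)))%:~R.
have arc_inj : injective (fun i => (v i, v (ordS i))).
  by move=> i j [/v_inj].
have prod_s : \prod_i s i = a ^+ n.+1.
  rewrite a_root arcsE big_imset /=; last by move=> i j _ _; apply: arc_inj.
  by rewrite rmorph_prod.
have s_neq0 i : s i != 0.
  have : (v i, v (ordS i)) \in arcs S by rewrite arcsE imset_f.
  by rewrite /s => /sign_arc[]->; rewrite ?rmorphN1 ?oppr_eq0 oner_eq0.
have a_neq0 : a != 0.
  apply/eqP => a0; have /prodf_neq0/negP[] : forall i, true -> s i != 0 by [].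
  by rewrite prod_s a0 expr0n.
(* [w m] is the eigenvector's entry after [m] arcs. The hypothesis on [a] gives [w n.+1 = w 0], so
   the values close up around the cycle. *)
pose w (m : nat) : F := (\prod_(k < n.+1 | (k < m)%N) s k) / a ^+ m.
have w0 : w 0 = 1 by rewrite /w big_pred0 // mul1r invr1.
have w_last : w n.+1 = 1.
  rewrite /w (eq_bigl (fun=> true)) => [|k]; last by rewrite ltn_ord.
  by rewrite prod_s divff // expf_neq0.
have wS (k : 'I_n.+1) : w (ordS k) = w k * s k / a.
  have -> : w (ordS k) = w k.+1.
    rewrite /=; have [k_lt | k_ge] := ltnP k.+1 n.+1.
      by rewrite modn_small.
    have -> : k.+1 = n.+1 by apply/eqP; rewrite eqn_leq k_ge ltn_ord.
    by rewrite modnn w0.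
  rewrite /w (bigD1 k) //= exprSr invfM.
  rewrite (eq_bigl (fun i : 'I_n.+1 => (i < k)%N)); last first.
    by move=> i; rewrite ltnS ltn_neqAle andbC.
  by rewrite (mulrC (s k)) -!mulrA (mulrCA (s k)).
apply/eigenvalueP; exists (\row_j w (g (enum_val j))); last first.
  apply/eqP => /rowP/(_ (enum_rank (v ord0))).
  rewrite !mxE enum_rankK vK w0 => /eqP.
  by rewrite oner_eq0.
apply/rowP => j; rewrite !mxE.
(* The eigenvector is a row, so entry [j] of the product sums over the arcs entering that vertex.
   The only one comes from its predecessor. *)
pose k := ord_pred (g (enum_val j)).
have vSk : enum_val j = v (ordS k) by rewrite ord_predK gK.
rewrite (bigD1 (enum_rank (v k))) //= !mxE big1 => [|i i_neq].
  rewrite enum_rankK vSk !vK wS arcsE /= imset_f // addr0.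
  by rewrite [RHS]mulrC divfK.
rewrite [adjmx _ _ _ _]mxE /=; case: ifP => [|_]; last by rewrite mulr0.
rewrite arcsE => /imsetP[l _ [vi]]; rewrite vSk => /v_inj/ordS_inj kl.
by case/eqP: i_neq; rewrite kl -vi enum_valK.
Qed.

(** * The energy as a sum of absolute cosines *)

Definition expi (R : realType) (x : R) : R[i]%C := Complex (cos x) (sin x).

Lemma expi_exp (R : realType) (x : R) (n : nat) :
  expi R x ^+ n = expi R (n%:R * x).
Proof.
elim: n => [|n IHn]; first by rewrite mul0r /expi cos0 sin0.
rewrite exprS IHn -natr1 mulrDl mul1r addrC /expi cosD sinD.
by apply/eqP; rewrite eq_complex /=; apply/andP; split; apply/eqP; ring.
Qed.

Lemma expi_natpi (R : realType) (n : nat) :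
  expi R (n%:R * pi) = (-1) ^+ n.
Proof.
rewrite -expi_exp; congr (_ ^+ _); rewrite /expi cospi sinpi.
by apply/eqP; rewrite eq_complex /= oppr0 !eqxx.
Qed.

Lemma expi_neq (R : realType) (x y : R) :
  x < y < x + 2 * pi -> expi R x <> expi R y.
Proof.
move=> /andP[lt_xy lt_yx] [cosxy sinxy].
(* With [u = (y - x) / 2] strictly between 0 and [pi], this contradicts
   [cos (2 u) = 1 - 2 sin^2 u < 1]. *)
have : cos (y - x) = 1.
  by rewrite cosB cosxy sinxy -!expr2 cos2Dsin2.
have -> : y - x = (y - x) / 2 + (y - x) / 2 by lra.
have : 0 < sin ((y - x) / 2) by apply: sin_gt0_pi; lra.
rewrite cosD; have := cos2Dsin2 ((y - x) / 2); nra.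
Qed.

Lemma energy_dicycle (R : realType) (n e : nat) (V : finType)
    (S : sidigraph V) :
  (0 < n)%N -> is_dicycle n S -> \prod_(a in arcs S) sign S a = (-1) ^+ e ->
  energy R S = \sum_(j < n) `|cos ((2 * j + e)%:R * (pi / n%:R) : R)|.
Proof.
move=> n_gt0 S_cycle S_sign.
have n_gt0R : (0 : R) < n%:R by rewrite ltr0n.
have n_neq0 : (n%:R : R) != 0 by rewrite gt_eqF.
have card_V : #|V| = n.
  have [v v_bij _] := S_cycle.
  by rewrite -(bij_eq_card v_bij) card_ord.
pose z (j : 'I_n) := expi R ((2 * j + e)%:R * (pi / n%:R)).
have z_neq (j k : 'I_n) : (j < k)%N -> z j <> z k.
  move=> lt_jk; apply: expi_neq.
  have -> : (2 : R) * pi = (2 * n)%:R * (pi / n%:R) by rewrite natrM; field.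
  have h_gt0 : (0 : R) < pi / n%:R by rewrite divr_gt0 ?pi_gt0.
  rewrite -mulrDl -natrD !ltr_pM2r // !ltr_nat.
  by move: (ltn_ord k); lia.
have z_inj : injective z.
  move=> j k zjk; apply: val_inj => /=.
  by have [/z_neq/(_ zjk)|/z_neq/(_ (esym zjk))|] := ltngtP j k.
have : perm_eq (eigenvalues (adjmx R[i]%C S)) [seq z j | j <- enum 'I_n].
  apply: perm_eigenvalues.
  - by rewrite map_inj_uniq // enum_uniq.
  - by rewrite size_map size_enum_ord card_V.
  move=> _ /mapP[j _ ->]; apply: (eigenvalue_dicycle _ n) => //.
  rewrite S_sign expi_exp mulrCA (mulrC n%:R) divfK // expi_natpi.
  by rewrite exprD exprM sqrrN !expr1n mul1r rmorphXn rmorphN1.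
by move=> z_perm; rewrite /energy (perm_big _ z_perm) big_map big_enum.
Qed.

(** * Sums of absolute cosines over equally spaced angles *)

Lemma sum_shift_periodic (U : zmodType) (f : nat -> U) (m s : nat) :
  (forall j, f (j + m)%N = f j) ->
  \sum_(j < m) f (j + s)%N = \sum_(j < m) f j.
Proof.
move=> f_per; elim: s => [|s IHs]; first by under eq_bigr do rewrite addn0.
(* With [f s = f (s + m)] added, both sides sum [f] from [s] to [s + m]; one splits off the first
   term, the other the last. *)
rewrite -{}IHs; apply: (addrI (f s)).
rewrite -[in RHS](f_per s) (addrC (f (s + m)%N)) addnC.
rewrite -(big_ord_recr m (fun j => f (j + s)%N)) big_ord_recl add0n.
by congr (_ + _); apply: eq_bigr => j _; rewrite /= addSnnS.
Qed.

Lemma normr_cosDpi (R : realType) (x : R) : `|cos (x + pi)| = `|cos x|.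
Proof. by rewrite cosDpi normrN. Qed.

(** Telescoping of [2 sin (t/2) cos x = sin (x + t/2) - sin (x - t/2)]. *)
Lemma sum_cos_arith (R : realType) (a t : R) (m : nat) :
  2 * sin (t / 2) * \sum_(j < m) cos (a + j%:R * t) =
  sin (a + m%:R * t - t / 2) - sin (a - t / 2).
Proof.
elim: m => [|m IHm]; first by rewrite big_ord0 mul0r addr0 mulr0 subrr.
rewrite big_ord_recr /= mulrDr {}IHm -(@natr1 _ m).
have -> : a + (m%:R + 1) * t - t / 2 = a + m%:R * t + t / 2 by lra.
rewrite (sinB (a + m%:R * t)) (sinD (a + m%:R * t)); ring.
Qed.

(** The bounds on [b] place the first angle at or after [pi/2] and the last, [b + (m - 1) pi / m],
    at or before [3 pi / 2], so no cosine is positive. *)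
Lemma sum_abs_cos (R : realType) (m : nat) (b : R) :
  (0 < m)%N -> pi / 2 <= b <= pi / 2 + pi / m%:R ->
  \sum_(j < m) `|cos (b + j%:R * (pi / m%:R))| =
  sin (b - pi / (2 * m%:R)) / sin (pi / (2 * m%:R)).
Proof.
move=> m_gt0 /andP[b_ge b_le].
have m_gt0R : (1 : R) <= m%:R by rewrite ler1n.
have m_neq0 : (m%:R : R) != 0 by rewrite pnatr_eq0 -lt0n.
have pi0 := pi_gt0 R.
set h : R := pi / m%:R in b_le *.
have h_gt0 : 0 < h by rewrite divr_gt0 // ltr0n.
have mh : m%:R * h = pi by rewrite /h mulrC divfK.
have -> : pi / (2 * m%:R) = h / 2 by rewrite /h; field.
have s_gt0 : 0 < sin (h / 2) by apply: sin_gt0_pi; nra.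
rewrite (eq_bigr (fun j : 'I_m => - cos (b + j%:R * h))) => [|j _]; last first.
  have : 0 <= - cos (b + j%:R * h).
    rewrite -cosDpi.
    have -> : b + j%:R * h + pi = (b + j%:R * h - pi) + pi *+ 2 by lra.
    rewrite cosD2pi; apply: cos_ge0_pihalf.
    have : j.+1%:R * h <= pi by rewrite -mh ler_pM2r // ler_nat.
    have : 0 <= j%:R * h by rewrite mulr_ge0 // ltW.
    by rewrite -(@natr1 _ j) mulrDl mul1r; lra.
  by rewrite oppr_ge0 => /ler0_norm.
have := sum_cos_arith R b h m; rewrite mh sumrN.
(* The [m] steps add up to [pi], so the two ends of the telescoped sum are opposite and the factor 2
   cancels. *)
have -> : b + pi - h / 2 = b - h / 2 + pi by lra.
rewrite sinDpi => sum_eq; apply: (mulIf (lt0r_neq0 s_gt0)).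
by rewrite divfK ?gt_eqF //; nra.
Qed.

Lemma sum_even_odd (U : zmodType) (f : nat -> U) (m : nat) :
  \sum_(j < 2 * m) f j = \sum_(j < m) f (2 * j)%N + \sum_(j < m) f (2 * j + 1)%N.
Proof.
elim: m => [|m IHm]; first by rewrite !big_ord0 addr0.
by rewrite mulnS !big_ord_recr /= {}IHm [RHS]addrACA -addrA addn1.
Qed.

(** Shifting [j] by [(n + 1) / 2], the inverse of 2 modulo [n], raises [2 j + d] by 1 modulo [n], so
    the sum does not depend on [e]. The sums for [e = 0] and [e = 1] together cover two periods. *)
Lemma sum_double_periodic (R : numDomainType) (f : nat -> R) (n e : nat) :
  odd n -> (forall j, f (j + n)%N = f j) ->
  \sum_(j < n) f (2 * j + e)%N = \sum_(j < n) f j.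
Proof.
move=> n_odd f_per.
have f_per2 d j : f (2 * (j + n) + d)%N = f (2 * j + d)%N.
  by rewrite -(f_per (2 * j + d)%N) -(f_per (2 * j + d + n)%N); congr f; lia.
have indep d : \sum_(j < n) f (2 * j + d)%N = \sum_(j < n) f (2 * j)%N.
  elim: d => [|d IHd]; first by under eq_bigr do rewrite addn0.
  rewrite -{}IHd.
  rewrite -(sum_shift_periodic _ (fun j => f (2 * j + d)%N) n n./2.+1) //.
  apply: eq_bigr => j _; rewrite -(f_per (2 * j + d.+1)%N).
  by congr f; move: (odd_double_half n); rewrite n_odd; lia.
rewrite indep; apply: (@pmulrnI R 2) => //=.
rewrite !mulr2n -{2}(indep 1%N) -sum_even_odd mul2n -addnn big_split_ord /=.
congr (_ + _); apply: eq_bigr => j _.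
by rewrite addnC f_per.
Qed.

(** The summand has period [m] in [j], so the sum is twice that over [m] terms starting at [j = s].
    The condition on [s] says that the first angle lies between [pi/2] and [pi/2 + pi/m]. *)
Lemma sum_abs_cos_even (R : realType) (m e s : nat) :
  (0 < m)%N -> (m <= 2 * s + e <= m + 2)%N ->
  \sum_(j < 2 * m) `|cos ((2 * j + e)%:R * (pi / (2 * m)%:R) : R)| =
  2 * (sin ((2 * s + e)%:R * (pi / (2 * m)%:R) - pi / (2 * m)%:R) /
       sin (pi / (2 * m)%:R)).
Proof.
move=> m_gt0 /andP[s_ge s_le].
have m_neq0 : (m%:R : R) != 0 by rewrite pnatr_eq0 -lt0n.
have m_gt0R : (0 : R) < m%:R by rewrite ltr0n.
pose f j : R := `|cos ((2 * j + e)%:R * (pi / (2 * m)%:R))|.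
have f_per j : f (j + m)%N = f j.
  rewrite /f -[RHS]normr_cosDpi; congr `|cos _|.
  by rewrite !(natrD, natrM); field.
rewrite -[LHS]/(\sum_(j < 2 * m) f j) [in LHS]mul2n -addnn
  big_split_ord /=.
under [X in _ + X = _]eq_bigr do rewrite addnC f_per.
rewrite -(sum_shift_periodic _ f m s f_per) mulr_natl mulr2n.
have -> : \sum_(j < m) f (j + s)%N = \sum_(j < m)
    `|cos ((2 * s + e)%:R * (pi / (2 * m)%:R) + j%:R * (pi / m%:R))|.
  apply: eq_bigr => j _; congr `|cos _|.
  by rewrite !(natrD, natrM); field.
rewrite sum_abs_cos //; first by rewrite natrM.
have h_gt0 : (0 : R) < pi / (2 * m%:R).
  by rewrite divr_gt0 ?pi_gt0 // mulr_gt0.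
have -> : (pi : R) / 2 = m%:R * (pi / (2 * m%:R)) by field.
have -> : (pi : R) / m%:R = 2 * (pi / (2 * m%:R)) by field.
by rewrite natrM -mulrDl -natrD !ler_pM2r // !ler_nat s_ge.
Qed.

Lemma sum_abs_cos_odd (R : realType) (n e : nat) :
  odd n ->
  \sum_(j < n) `|cos ((2 * j + e)%:R * (pi / n%:R) : R)| =
  csc (pi / (2 * n%:R) : R).
Proof.
move=> n_odd; have n_gt0 := odd_gt0 n_odd.
have n_neq0 : (n%:R : R) != 0 by rewrite pnatr_eq0 -lt0n.
pose f j : R := `|cos (j%:R * (pi / n%:R))|.
have f_per j : f (j + n)%N = f j.
  by rewrite /f -[RHS]normr_cosDpi; congr `|cos _|; rewrite natrD; field.
rewrite (sum_double_periodic R f) // -(sum_shift_periodic _ f n n./2.+1) //.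
have def_n : (2 * n./2.+1 = n + 1)%N.
  by move: (odd_double_half n); rewrite n_odd; lia.
(* Starting at [s = (n + 1) / 2] puts the first angle half a step after [pi/2], so the numerator in
   [sum_abs_cos] is [sin (pi/2)]. *)
set s := n./2.+1 in def_n *.
have def_s : (s%:R : R) = (n%:R + 1) / 2.
  by have /(congr1 (GRing.natmul (1 : R))) := def_n; rewrite natrM natrD; lra.
have -> : \sum_(j < n) f (j + s)%N = \sum_(j < n)
    `|cos (s%:R * (pi / n%:R) + j%:R * (pi / n%:R))|.
  by apply: eq_bigr => j _; rewrite /f natrD mulrDl addrC.
rewrite sum_abs_cos //.
  have -> : s%:R * (pi / n%:R) - pi / (2 * n%:R) = pi / 2 :> R.
    by rewrite def_s; field.
  by rewrite sin_pihalf /csc mul1r.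
have -> : s%:R * (pi / n%:R) = pi / 2 + pi / n%:R / 2 :> R.
  by rewrite def_s; field.
have : (0 : R) < pi / n%:R by rewrite divr_gt0 ?pi_gt0 ?ltr0n.
by lra.
Qed.

(* If [m + e] is even, some angle is exactly [pi / 2]. *)
Lemma sum_abs_cos_cot (R : realType) (m e : nat) :
  (0 < m)%N -> (e <= 1)%N -> ~~ odd (m + e) ->
  \sum_(j < 2 * m) `|cos ((2 * j + e)%:R * (pi / (2 * m)%:R) : R)| =
  2 * cot (pi / (2 * m)%:R).
Proof.
move=> m_gt0 e_le me_even; have := odd_double_half (m + e).
rewrite (negbTE me_even) => def_me.
(* The witness solves [2 s + e = m]; the natural subtraction is not truncated, as [e <= 1 <= m]. *)
have -> := sum_abs_cos_even R m e ((m + e)./2 - e) m_gt0; last by lia.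
have -> : (2 * ((m + e)./2 - e) + e = m)%N by lia.
have m_neq0 : (m%:R : R) != 0 by rewrite pnatr_eq0 -lt0n.
have -> : m%:R * (pi / (2 * m)%:R) = pi / 2 :> R by rewrite natrM; field.
by rewrite /cot -[pi / 2 - _]opprB sinN sinBpihalf opprK.
Qed.

(* If [m + e] is odd, [pi / 2] is halfway between two consecutive angles. *)
Lemma sum_abs_cos_csc (R : realType) (m e : nat) :
  (0 < m)%N -> (e <= 1)%N -> odd (m + e) ->
  \sum_(j < 2 * m) `|cos ((2 * j + e)%:R * (pi / (2 * m)%:R) : R)| =
  2 * csc (pi / (2 * m)%:R).
Proof.
move=> m_gt0 e_le me_odd; have := odd_double_half (m + e).
rewrite me_odd => def_me.
(* Here [2 s + e = m + 1], half a step after [pi/2]. *)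
have -> := sum_abs_cos_even R m e ((m + e)./2.+1 - e) m_gt0; last by lia.
have -> : (2 * ((m + e)./2.+1 - e) + e = m + 1)%N by lia.
have m_neq0 : (m%:R : R) != 0 by rewrite pnatr_eq0 -lt0n.
have -> : (m + 1)%:R * (pi / (2 * m)%:R) - pi / (2 * m)%:R = pi / 2 :> R.
  by rewrite natrD natrM; field.
by rewrite sin_pihalf mul1r.
Qed.

Theorem mainTheorem2 (R : realType) (n : nat) (hn : (2 <= n)%N) :
  (forall (V : finType) (C : sidigraph V), positive_dicycle n C ->
     forall k : nat,
       [/\ n = (4 * k)%N -> energy R C = 2 * cot (pi / n%:R),
           n = (4 * k + 1)%N \/ n = (4 * k + 3)%N ->
             energy R C = csc (pi / (2 * n%:R))
         & n = (4 * k + 2)%N -> energy R C = 2 * csc (pi / n%:R)]) /\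
  (forall (V : finType) (C : sidigraph V), negative_dicycle n C ->
     forall k : nat,
       [/\ n = (4 * k)%N -> energy R C = 2 * csc (pi / n%:R),
           n = (4 * k + 1)%N \/ n = (4 * k + 3)%N ->
             energy R C = csc (pi / (2 * n%:R))
         & n = (4 * k + 2)%N -> energy R C = 2 * cot (pi / n%:R)]).
Proof.
split=> V C [C_cycle C_sign] k; have n_gt0 := ltnW hn.
  (* For even [n = 2 m], [m] is [2 k] or [2 k + 1], and the parity of [m + e] selects [cot] or
     [csc]; changing the sign of the cycle changes [e] and swaps them. *)
  have -> := energy_dicycle R n 0 V C n_gt0 C_cycle C_sign.
  split=> [n_eq | n_eq | n_eq].
  - have n_eq2 : n = (2 * (2 * k))%N by lia.
    by rewrite n_eq2 sum_abs_cos_cot //; lia.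
  - by apply: sum_abs_cos_odd; lia.
  - have n_eq2 : n = (2 * (2 * k + 1))%N by lia.
    by rewrite n_eq2 sum_abs_cos_csc //; lia.
have -> := energy_dicycle R n 1 V C n_gt0 C_cycle C_sign.
split=> [n_eq | n_eq | n_eq].
- have n_eq2 : n = (2 * (2 * k))%N by lia.
  by rewrite n_eq2 sum_abs_cos_csc //; lia.
- by apply: sum_abs_cos_odd; lia.
- have n_eq2 : n = (2 * (2 * k + 1))%N by lia.
  by rewrite n_eq2 sum_abs_cos_cot //; lia.
Qed.
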